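(* Let $\mathbb{K}\in\{\mathbb{R},\mathbb{C}\}$, let $H \in \mathbb{K}^{n\times n}$ be a nonsingular selfadjoint matrix and let $\Phi \in \mathbb{K}^{n\times n}$ be an $H$-selfadjoint involutory matrix whose negative eigenspace is hyperbolic. Then any $(H\Phi, H)$-unitary matrix $W \in \mathbb{K}^{n\times n}$ can be factorized (non-uniquely) as $$W=XL,$$ where $L \in \mathbb{K}^{n\times n}$ is $H$-unitary and $X \in \mathbb{K}^{n\times n}$ is $H$-normal $H$-neutral involutory.
   Context: For a matrix $A$ over $\mathbb{K}$, $A^\dagger$ denotes the conjugate transpose if $\mathbb{K}=\mathbb{C}$ and the transpose if $\mathbb{K}=\mathbb{R}$; $A$ is selfadjoint if $A^\dagger=A$. For a nonsingular selfadjoint $H\in\mathbb{K}^{n\times n}$ put $[x,y]_H=x^\dagger H y$ for $x,y\in\mathbb{K}^n$, and $A^{[H]}=H^{-1}A^\dagger H$ (the $H$-adjoint). A matrix $A\in\mathbb{K}^{n\times n}$ is $H$-selfadjoint if $A^{[H]}=A$, $H$-unitary if $A^{[H]}A=AA^{[H]}=I_n$, and $H$-normal if $AA^{[H]}=A^{[H]}A$. For congruent nonsingular selfadjoint $H_1,H_2\in\mathbb{K}^{n\times n}$, a matrix $W\in\mathbb{K}^{n\times n}$ is $(H_1,H_2)$-unitary if $W^\dagger H_1W=H_2$. In particular $W$ is $(H\Phi,H)$-unitary if and only if $WW^{[H]}=\Phi$. A matrix $X\in\mathbb{K}^{n\times n}$ is involutory if $X^2=I_n$; its negative eigenspace is $\{v\in\mathbb{K}^n: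 Xv=-v\}$. A subspace is hyperbolic if it is nondegenerate with respect to $[\cdot,\cdot]_H$ and the restriction of $[\cdot,\cdot]_H$ to it has signature zero (equally many positive and negative squares; the zero subspace qualifies). A subspace $\mathcal{N}$ is $H$-neutral if $[u,v]_H=0$ for all $u,v\in\mathcal{N}$. An involutory $X$ is $H$-neutral if its negative eigenspace is $H$-neutral or $\{0\}$. $X$ is $H$-normal $H$-neutral involutory if it is involutory, $H$-neutral and $H$-normal.
   Formalization: Non-uniqueness of the factorization W = XL is asserted only for Φ ≠ I; for Φ = I the factorization is unique (X = I, L = W), so the parenthetical ''non-uniquely'' fails there. *)

(* Defs.v *)
From mathcomp Require Import all_boot all_order all_algebra.
From mathcomp Require Import complex reals.

Set Implicit Arguments.
Unset Strict Implicit.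
Unset Printing Implicit Defensive.

Import Order.TTheory GRing.Theory Num.Theory.
Local Open Scope ring_scope.

Variant base_field := RealField | ComplexField.

Definition scalars (R : realType) (F : base_field) : numFieldType :=
  match F with RealField => R | ComplexField => R[i] end.

Definition conj_scalars (R : realType) (F : base_field) :
    scalars R F -> scalars R F :=
  match F with RealField => id | ComplexField => @conjc R end.

Section IndefiniteInnerProduct.

(* Used only with K and conj given by scalars and conj_scalars. *)
Variables (K : numFieldType) (conj : K -> K).

Definition adjmx m n (A : 'M[K]_(m, n)) : 'M[K]_(n, m) := map_mx conj A^T.

Definition selfadjoint n (A : 'M[K]_n) : Prop := adjmx A = A.

Definition H_form n (H : 'M[K]_n) (x y : 'cV[K]_n) : K :=
  (adjmx x *m H *m y) 0 0.

Definition H_adjoint n (H A : 'M[K]_n) : 'M[K]_n :=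
  invmx H *m adjmx A *m H.

Definition H_selfadjoint n (H A : 'M[K]_n) : Prop := H_adjoint H A = A.

Definition H_unitary n (H A : 'M[K]_n) : Prop :=
  H_adjoint H A *m A = 1%:M /\ A *m H_adjoint H A = 1%:M.

Definition H_normal n (H A : 'M[K]_n) : Prop :=
  A *m H_adjoint H A = H_adjoint H A *m A.

(* When H2 is nonsingular, this equation already forces W to be nonsingular
   and H1, H2 to be congruent. *)
Definition HH_unitary n (H1 H2 W : 'M[K]_n) : Prop :=
  adjmx W *m H1 *m W = H2.

Definition involutory n (X : 'M[K]_n) : Prop := X *m X = 1%:M.

(* Matrices act on column vectors from the left, so this is
   {v | X *m v = - v}; eigenspace from mxalgebra is about row vectors. *)
Definition negative_eigenspace n (X : 'M[K]_n) : {vspace 'cV[K]_n} :=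
  passmx.leigenspace (linfun (mulmx X : 'cV[K]_n -> 'cV[K]_n)) (-1).

Definition nondegenerate n (H : 'M[K]_n) (U : {vspace 'cV[K]_n}) : Prop :=
  forall u, u \in U -> (forall v, v \in U -> H_form H u v = 0) -> u = 0.

(* The form restricted to U is diagonalised with p positive and q negative
   squares; for selfadjoint H, (p, q) depends only on U by Sylvester's law.
   For K = R[i], the order only relates numbers with equal imaginary part. *)
Definition has_squares n (H : 'M[K]_n) (U : {vspace 'cV[K]_n}) (p q : nat)
    : Prop :=
  exists b : seq 'cV[K]_n,
    [/\ basis_of U b,
        {in b &, forall u v, u != v -> H_form H u v = 0},
        count (fun v => 0 < H_form H v v) b = p
      & count (fun v => H_form H v v < 0) b = q].

Definition hyperbolic n (H : 'M[K]_n) (U : {vspace 'cV[K]_n}) : Prop :=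
  nondegenerate H U /\ exists p : nat, has_squares H U p p.

Definition neutral_subspace n (H : 'M[K]_n) (U : {vspace 'cV[K]_n}) : Prop :=
  {in U &, forall u v, H_form H u v = 0}.

Definition H_neutral n (H X : 'M[K]_n) : Prop :=
  neutral_subspace H (negative_eigenspace X) \/
  negative_eigenspace X = 0%VS.

Definition H_normal_H_neutral_involutory n (H X : 'M[K]_n) : Prop :=
  [/\ involutory X, H_neutral H X & H_normal H X].

End IndefiniteInnerProduct.

(* Main.v *)
(* The negative eigenspace of Phi has an H-orthonormal basis consisting of
   positive vectors e_1, ..., e_p and negative vectors f_1, ..., f_p. The vectors
   e_i - f_i and e_i + f_i span complementary neutral subspaces; the projection P
   onto the former, along the latter and the positive eigenspace of Phi,
   satisfies P P^[H] = P^[H] P = 0 and P + P^[H] = (1 - Phi) / 2. Therefore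
   X = 1 - 2 P is a normal neutral involution with X X^[H] = Phi = W W^[H], and
   L = X W is H-unitary. Exchanging P and P^[H] gives a second factorization. *)
Require Import Defs.
From mathcomp Require Import all_boot all_order all_algebra.
From mathcomp Require Import complex reals ring.

Import Order.TTheory GRing.Theory Num.Theory.
Local Open Scope ring_scope.

(** * Columns, conjugate transposes and Gram matrices *)

Section HAdjoint.
Set Implicit Arguments.
Unset Strict Implicit.

Lemma col_mulmx (S : pzSemiRingType) m n p (A : 'M[S]_(m, n)) (B : 'M_(n, p)) j :
  col j (A *m B) = A *m col j B.
Proof.
by apply/colP=> i; rewrite !mxE; apply: eq_bigr => k _; rewrite !mxE.
Qed.

Lemma eq_cols (T : Type) m n (A B : 'M[T]_(m, n)) :
  (forall j, col j A = col j B) -> A = B.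
Proof. by move=> AB; apply/matrixP=> i j; have /colP/(_ i) := AB j; rewrite !mxE. Qed.

Lemma colmx_of_seq (T : nmodType) m p (c : seq 'cV[T]_m) :
  size c = p -> exists C : 'M[T]_(m, p), forall j, col j C = nth 0 c j.
Proof.
by exists (\matrix_(i, j) nth 0 c j i 0) => j; apply/colP=> i; rewrite !mxE.
Qed.

Variables (K : numFieldType) (conj : {rmorphism K -> K}).
Hypothesis conjK : involutive conj.

Lemma adjmxM m n q (A : 'M[K]_(m, n)) (B : 'M_(n, q)) :
  adjmx conj (A *m B) = adjmx conj B *m adjmx conj A.
Proof. by rewrite /adjmx trmx_mul map_mxM. Qed.

Lemma adjmxD m n (A B : 'M[K]_(m, n)) :
  adjmx conj (A + B) = adjmx conj A + adjmx conj B.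
Proof. by rewrite /adjmx linearD map_mxD. Qed.

Lemma adjmxB m n (A B : 'M[K]_(m, n)) :
  adjmx conj (A - B) = adjmx conj A - adjmx conj B.
Proof. by rewrite /adjmx linearB map_mxB. Qed.

Lemma adjmxZ m n (a : K) (A : 'M[K]_(m, n)) :
  adjmx conj (a *: A) = conj a *: adjmx conj A.
Proof. by rewrite /adjmx linearZ map_mxZ. Qed.

Lemma adjmx1 n : adjmx conj (1%:M : 'M_n) = 1%:M.
Proof. by rewrite /adjmx trmx1 map_mx1. Qed.

Lemma adjmxK m n (A : 'M[K]_(m, n)) : adjmx conj (adjmx conj A) = A.
Proof. by apply/matrixP=> i j; rewrite !mxE conjK. Qed.

Lemma adjmx_inv n (A : 'M[K]_n) :
  adjmx conj (invmx A) = invmx (adjmx conj A).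
Proof. by rewrite /adjmx trmx_inv map_invmx. Qed.

(** Translates orthogonality relations between vectors into matrix identities, so that a whole frame
    is handled as one matrix of columns. *)
Lemma gramE n p q (H : 'M[K]_n) (A : 'M_(n, p)) (B : 'M_(n, q)) i j :
  (adjmx conj A *m H *m B) i j = H_form conj H (col i A) (col j B).
Proof.
rewrite /H_form !mxE; apply: eq_bigr => k _; rewrite !mxE.
by congr (_ * _); apply: eq_bigr => l _; rewrite !mxE.
Qed.

(** * The [H]-adjoint as an involutive antiautomorphism *)

Variables (n : nat) (H : 'M[K]_n).
Hypotheses (H_unit : H \in unitmx) (H_sa : selfadjoint conj H).

Local Notation "A ^[*]" := (H_adjoint conj H A) (at level 2, format "A ^[*]").

Lemma H_form_conj (x y : 'cV[K]_n) : conj (H_form conj H x y) = H_form conj H y x.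
Proof.
have -> : conj (H_form conj H x y) = adjmx conj (adjmx conj x *m H *m y) 0 0.
  by rewrite /H_form !mxE.
by rewrite !adjmxM H_sa adjmxK mulmxA.
Qed.

Lemma H_adjointM (A B : 'M[K]_n) : (A *m B)^[*] = B^[*] *m A^[*].
Proof.
rewrite /H_adjoint adjmxM !mulmxA; congr (_ *m _ *m _).
by rewrite mulmxK.
Qed.

Lemma H_adjointD (A B : 'M[K]_n) : (A + B)^[*] = A^[*] + B^[*].
Proof. by rewrite /H_adjoint adjmxD mulmxDr mulmxDl. Qed.

Lemma H_adjointB (A B : 'M[K]_n) : (A - B)^[*] = A^[*] - B^[*].
Proof. by rewrite /H_adjoint adjmxB mulmxBr mulmxBl. Qed.

Lemma H_adjointZ (a : K) (A : 'M[K]_n) : (a *: A)^[*] = conj a *: A^[*].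
Proof. by rewrite /H_adjoint adjmxZ -scalemxAr -scalemxAl. Qed.

Lemma H_adjoint1 : 1%:M^[*] = 1%:M.
Proof. by rewrite /H_adjoint adjmx1 mulmx1 mulVmx. Qed.

Lemma H_adjointK (A : 'M[K]_n) : (A^[*])^[*] = A.
Proof.
rewrite /H_adjoint !adjmxM adjmxK adjmx_inv H_sa.
by rewrite -!mulmxA mulVmx // mulmx1 mulmxA mulVmx // mul1mx.
Qed.

Lemma gram_eq0_sym p q (E : 'M[K]_(n, p)) (F : 'M_(n, q)) :
  adjmx conj E *m H *m F = 0 -> adjmx conj F *m H *m E = 0.
Proof.
move/(congr1 (@adjmx K conj p q)).
by rewrite !adjmxM adjmxK H_sa mulmxA /adjmx trmx0 map_mx0.
Qed.

(** The neutral projection will have this factored shape; passing to its adjoint merely exchanges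
    [U] and [M]. *)
Lemma H_adjoint_rank (p : nat) (U M : 'M[K]_(n, p)) :
  (U *m adjmx conj M *m H)^[*] = M *m adjmx conj U *m H.
Proof.
by rewrite /H_adjoint !adjmxM adjmxK H_sa !mulmxA mulVmx // mul1mx.
Qed.

Lemma mem_negative_eigenspace (X : 'M[K]_n) (v : 'cV_n) :
  (v \in negative_eigenspace X) = (X *m v == - v).
Proof.
by rewrite memv_ker scaleN1r opprK add_lfunE lfunE /= id_lfunE addr_eq0.
Qed.

(** The fixed vectors of a linear map form a subspace, so generators suffice. *)
Lemma fixmx_span (Q : 'M[K]_n) (b : seq 'cV[K]_n) (v : 'cV_n) :
  {in b, forall w, Q *m w = w} -> v \in <<b>>%VS -> Q *m v = v.
Proof.
move=> fixQ b_v; suff: v \in fixedSpace (linfun (mulmx Q)).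
  by move/fixedSpaceP; rewrite lfunE.
move: b_v; apply/subvP/span_subvP => w b_w.
by apply/fixedSpaceP; rewrite lfunE /= fixQ.
Qed.

(** * Reflections [1 - 2 P] in a projection that its adjoint annihilates *)

Section Reflection.
Variable P : 'M[K]_n.
Hypotheses (PP : P *m P = P) (PPa : P *m P^[*] = 0) (PaP : P^[*] *m P = 0).

Let X : 'M[K]_n := 1%:M - 2 *: P.

Lemma H_adjoint_reflection : X^[*] = 1%:M - 2 *: P^[*].
Proof. by rewrite H_adjointB H_adjoint1 H_adjointZ rmorph_nat. Qed.

Lemma reflection_involutory : involutory X.
Proof.
rewrite /involutory /X mulmxBr mulmx1 mulmxBl mul1mx -scalemxAl -scalemxAr PP.
by rewrite [2 *: (2 *: P)]scaler_nat mulr2n opprB addrK subrK.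
Qed.

Lemma reflection_mul_adjoint : X *m X^[*] = 1%:M - 2 *: (P + P^[*]).
Proof.
rewrite H_adjoint_reflection /X mulmxBr mulmx1 mulmxBl mul1mx.
by rewrite -scalemxAl -scalemxAr PPa !scaler0 subr0 scalerDr opprD addrA.
Qed.

Lemma reflection_normal : H_normal conj H X.
Proof.
rewrite /H_normal reflection_mul_adjoint H_adjoint_reflection.
rewrite /X mulmxBr mulmx1 mulmxBl mul1mx.
by rewrite -scalemxAl -scalemxAr PaP !scaler0 subr0 scalerDr opprD addrA addrAC.
Qed.

(** From [X *m v = - v] follows [P *m v = v]. Hence on the negative eigenspace [u, v] = [P u, P v] =
    [u, [P^[*]] P v] = 0. *)
Lemma reflection_neutral : H_neutral conj H X.
Proof.
have fixP v : v \in negative_eigenspace X -> P *m v = v.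
  rewrite mem_negative_eigenspace mulmxBl mul1mx -scalemxAl => /eqP.
  move/(canRL (addKr _)); rewrite -opprD => /oppr_inj; rewrite -mulr2n -scaler_nat.
  by move/scalerI; apply; rewrite pnatr_eq0.
left=> u v /fixP Pu /fixP Pv.
rewrite /H_form -Pu -Pv adjmxM !mulmxA.
have -> : adjmx conj u *m adjmx conj P *m H = adjmx conj u *m H *m P^[*].
  by rewrite /H_adjoint -!mulmxA mulKVmx.
by rewrite -(mulmxA _ P^[*]) PaP mulmx0 mul0mx mxE.
Qed.

Lemma reflection_factorization (Phi W : 'M[K]_n) :
  Phi *m Phi = 1%:M -> W *m W^[*] = Phi -> Phi = 1%:M - 2 *: (P + P^[*]) ->
  [/\ W = X *m (X *m W), H_unitary conj H (X *m W)
    & H_normal_H_neutral_involutory conj H X].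
Proof.
move=> PhiPhi WW PhiE; have XX := reflection_involutory.
have XXa : X *m X^[*] = Phi by rewrite reflection_mul_adjoint.
(* With [X^[*] *m X = Phi], the product is [X Phi X^[*]] = [(X X^[*]) (X X^[*])] = [Phi Phi] = 1. *)
have LLa : (X *m W) *m (X *m W)^[*] = 1%:M.
  rewrite H_adjointM mulmxA -(mulmxA X W) WW.
  have XaX : X^[*] *m X = Phi by rewrite -reflection_normal.
  by move: (X^[*]) XXa XaX => Y XY YX; rewrite -YX !mulmxA XY -mulmxA XY.
split; first by rewrite mulmxA XX mul1mx.
  by split=> //; apply: mulmx1C.
by split; [exact: XX|exact: reflection_neutral|exact: reflection_normal].
Qed.

End Reflection.

(** * Construction of the neutral projection *)

Section NeutralProjection.
(** What the real and complex cases share: self-conjugate scalars are real, and positive scalars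
    have a self-conjugate square root [s]. *)
Hypothesis conj_real : forall x : K, conj x = x -> x \is Num.real.
Variable s : K -> K.
Hypothesis conj_sqrt : forall x : K, 0 < x -> conj (s x) = s x.
Hypothesis sqr_sqrt : forall x : K, 0 < x -> s x ^+ 2 = x.

(** Each column is divided by the square root of the absolute value of its square. The sign [eps]
    treats positive and negative vectors at once, and the invertibility of [D] lets [C] be recovered
    from the frame. *)
Lemma orthonormalization (p : nat) (C : 'M[K]_(n, p)) (eps : K) :
  eps * eps = 1 ->
  (forall i, 0 < eps * H_form conj H (col i C) (col i C)) ->
  (forall i j, i != j -> H_form conj H (col i C) (col j C) = 0) ->
  exists2 D : 'M[K]_p,
    D \in unitmx & adjmx conj (C *m D) *m H *m (C *m D) = eps%:M.
Proof.
move=> eps2 Cpos Corth.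
pose g i := H_form conj H (col i C) (col i C).
pose k i := (s (eps * g i))^-1.
have s_neq0 i : s (eps * g i) != 0.
  by rewrite -sqrf_eq0 sqr_sqrt ?Cpos // gt_eqF ?Cpos.
exists (diag_mx (\row_i k i)).
  rewrite unitmxE det_diag unitfE; apply/prodf_neq0 => i _.
  by rewrite mxE invr_eq0.
rewrite adjmxM -!mulmxA (mulmxA H) (mulmxA (adjmx conj C)) (mulmxA _ H).
rewrite /adjmx tr_diag_mx map_diag_mx -/(adjmx conj C).
apply/matrixP=> i j; rewrite mul_diag_mx mul_mx_diag [in LHS]mxE [in X in _ * X]mxE.
rewrite gramE !mxE fmorphV conj_sqrt ?Cpos //.
have [<-|ij] := eqVneq i j; last by rewrite Corth // mul0r mulr0.
have gE : g i = eps * s (eps * g i) ^+ 2 by rewrite sqr_sqrt ?Cpos // mulrA eps2 mul1r.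
by rewrite -/(g i) mulr1n {2}gE /k; field.
Qed.

Lemma neutral_projection_of_frame (p : nat) (E F : 'M[K]_(n, p)) :
  adjmx conj E *m H *m E = 1%:M -> adjmx conj F *m H *m F = (-1)%:M ->
  adjmx conj E *m H *m F = 0 ->
  exists P : 'M[K]_n,
    [/\ P *m P = P, P *m P^[*] = 0, P^[*] *m P = 0
      & P + P^[*] = (E *m adjmx conj E - F *m adjmx conj F) *m H].
Proof.
move=> EE FF EF; have FE := gram_eq0_sym EF.
have half : 2^-1 + 2^-1 = 1 :> K by field.
(* [U] and [M] span neutral subspaces, and the factor 1/2 makes them dual to each other: [MU] is the
   identity. Hence [U *m adjmx conj M *m H] is idempotent. *)
pose U := E - F; pose M := 2^-1 *: (E + F).
have adjM : adjmx conj M = 2^-1 *: (adjmx conj E + adjmx conj F).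
  by rewrite adjmxZ adjmxD fmorphV rmorph_nat.
have UU : adjmx conj U *m H *m U = 0.
  rewrite adjmxB !(mulmxBl, mulmxBr) EE FF EF FE raddfN /=.
  by rewrite subr0 sub0r opprK subrr.
have MM : adjmx conj M *m H *m M = 0.
  rewrite adjM /M -!scalemxAl -scalemxAr !(mulmxDl, mulmxDr) EE FF EF FE.
  by rewrite raddfN /= addr0 add0r subrr !scaler0.
have MU : adjmx conj M *m H *m U = 1%:M.
  rewrite adjM /U -!scalemxAl mulmxBr !mulmxDl EE FF EF FE.
  by rewrite raddfN /= addr0 add0r opprK scalerDr -scalerDl half scale1r.
have adjP := H_adjoint_rank U M.
have mulA (A B C D : 'M[K]_(n, p)) :
    A *m adjmx conj B *m H *m (C *m adjmx conj D *m H) =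
    A *m (adjmx conj B *m H *m C) *m adjmx conj D *m H.
  by rewrite !mulmxA.
exists (U *m adjmx conj M *m H); rewrite adjP !mulA MU UU MM; split.
- by rewrite mulmx1.
- by rewrite mulmx0 !mul0mx.
- by rewrite mulmx0 !mul0mx.
rewrite -mulmxDl; congr (_ *m H).
rewrite adjM /U /M adjmxB -scalemxAr -scalemxAl -scalerDr.
rewrite !(mulmxDl, mulmxDr) !mulNmx !mulmxN.
move: (E *m adjmx conj E) (E *m adjmx conj F) => a b.
move: (F *m adjmx conj E) (F *m adjmx conj F) => c d.
by apply/matrixP=> i j; rewrite !mxE; field.
Qed.

(** Both [P + P^[*]] and [(1 - Phi) / 2] are [H]-selfadjoint projections onto the negative
    eigenspace of [Phi], and such a projection is determined by its range. *)
Lemma neutral_projection_exists (Phi : 'M[K]_n) :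
  H_selfadjoint conj H Phi -> involutory Phi ->
  hyperbolic conj H (negative_eigenspace Phi) ->
  exists P : 'M[K]_n,
    [/\ P *m P = P, P *m P^[*] = 0, P^[*] *m P = 0
      & Phi = 1%:M - 2 *: (P + P^[*])].
Proof.
move=> Phi_sa PhiPhi [nondeg [p [b [b_basis b_orth b_pos b_neg]]]].
set V := negative_eigenspace Phi in nondeg b_basis.
have b_span : <<b>>%VS = V by apply/eqP; case/andP: b_basis.
have b_uniq : uniq b by apply/free_uniq/basis_free/b_basis.
pose pos := fun v => 0 < H_form conj H v v.
pose neg := fun v => H_form conj H v v < 0.
(* The two counts alone do not exclude basis vectors with square zero. Squares are real, being
   self-conjugate; a basis vector with square zero would be orthogonal to all of [V], hence zero by
   nondegeneracy, contradicting freeness. *)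
have b_signed v : v \in b -> pos v || neg v.
  move=> b_v; have : H_form conj H v v \is Num.real.
    by apply: conj_real; rewrite H_form_conj.
  rewrite /pos /neg; case/real_ltgt0P => // vv0; case/negP: (free_not0 (basis_free b_basis) b_v).
  apply/eqP/nondeg; first by rewrite -b_span memv_span.
  move=> w; rewrite -b_span => w_b.
  (* Orthogonality to [v] is membership in a kernel, so it passes from the basis to its span. *)
  have : w \in lker (linfun (mulmx (adjmx conj v *m H))).
    move: w_b; apply/subvP/span_subvP => u b_u; rewrite memv_ker lfunE /=.
    apply/eqP/matrixP=> i j; rewrite !ord1 [RHS]mxE.
    by have [<-//|uv] := eqVneq v u; apply: b_orth.
  by rewrite memv_ker lfunE /= /H_form => /eqP ->; rewrite mxE.
(* Used twice, with [eps] equal to 1 and -1, for the positive and the negative basis vectors. *)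
have frame eps (a : pred 'cV[K]_n) : eps * eps = 1 -> count a b = p ->
    (forall v, a v -> 0 < eps * H_form conj H v v) ->
    exists C : 'M[K]_(n, p), exists D : 'M[K]_p,
      [/\ D \in unitmx, adjmx conj (C *m D) *m H *m (C *m D) = eps%:M,
          forall j, a (col j C) && (col j C \in b)
        & forall v, v \in b -> a v -> exists j, v = col j C].
  move=> eps2 a_p a_sign; pose c := filter a b.
  have c_p : size c = p by rewrite size_filter.
  have [C colC] := colmx_of_seq c_p.
  have c_mem j : a (col j C) && (col j C \in b).
    by rewrite -mem_filter colC mem_nth // c_p.
  have [|i j ij|D D_unit CD] := @orthonormalization p C eps eps2.
  - by move=> i; apply: a_sign; case/andP: (c_mem i).
  - have /andP[_ bi] := c_mem i; have /andP[_ bj] := c_mem j.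
    apply: b_orth => //; rewrite !colC nth_uniq ?c_p //.
    exact: filter_uniq.
  exists C, D; split=> // v b_v a_v.
  have v_c : v \in c by rewrite mem_filter a_v.
  have v_p : (index v c < p)%N by rewrite -c_p index_mem.
  by exists (Ordinal v_p); rewrite colC nth_index.
have [|v|C [D [D_unit EE C_mem C_all]]] := frame 1 pos _ b_pos.
- by rewrite mulr1.
- by rewrite mul1r.
have [|v|C' [D' [D'_unit FF C'_mem C'_all]]] := frame (-1) neg _ b_neg.
- by rewrite mulrNN mulr1.
- by rewrite mulN1r oppr_gt0.
have CC' : adjmx conj C *m H *m C' = 0.
  apply/matrixP=> i j; rewrite gramE mxE.
  have /andP[posi bi] := C_mem i; have /andP[negj bj] := C'_mem j.
  apply: b_orth => //; apply: contraTneq posi => ->.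
  by rewrite /pos lt_gtF.
have EF : adjmx conj (C *m D) *m H *m (C' *m D') = 0.
  by rewrite adjmxM mulmxA -(mulmxA _ _ H) -(mulmxA _ _ C') CC' mulmx0 mul0mx.
have FE := gram_eq0_sym EF.
have [P [PP PPa PaP PE]] := neutral_projection_of_frame EE FF EF.
exists P; split=> //.
have Phi_b v : v \in b -> Phi *m v = - v.
  by move=> b_v; apply/eqP; rewrite -mem_negative_eigenspace -/V -b_span memv_span.
have Phi_col (B : 'M[K]_(n, p)) : (forall j, col j B \in b) -> Phi *m B = - B.
  by move=> bB; apply: eq_cols => j; rewrite col_mulmx Phi_b // linearN.
have PhiC : Phi *m C = - C by apply: Phi_col => j; case/andP: (C_mem j).
have PhiC' : Phi *m C' = - C' by apply: Phi_col => j; case/andP: (C'_mem j).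
set S := P + P^[*]; pose Q := 2^-1 *: (1%:M - Phi).
have half : 2^-1 + 2^-1 = 1 :> K by field.
have PhiS : Phi *m S = - S.
  rewrite /S PE !mulmxA mulmxBr !mulmxA PhiC PhiC' !mulNmx.
  by rewrite -opprD mulNmx.
have QS : Q *m S = S.
  by rewrite /Q -scalemxAl mulmxBl mul1mx PhiS opprK scalerDr -scalerDl half scale1r.
(* Writing [C] as [(C *m D) *m invmx D] brings in the Gram identities [EE] and [FE]. *)
have SC : S *m C = C.
  rewrite -(mulmxK D_unit C) mulmxA /S PE -(mulmxA _ H) mulmxBl.
  rewrite -!(mulmxA _ (adjmx conj _)) !(mulmxA (adjmx conj _)) EE FE.
  by rewrite mulmx1 mulmx0 subr0.
have SC' : S *m C' = C'.
  rewrite -(mulmxK D'_unit C') mulmxA /S PE -(mulmxA _ H) mulmxBl.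
  rewrite -!(mulmxA _ (adjmx conj _)) !(mulmxA (adjmx conj _)) EF FF.
  by rewrite mulmx0 sub0r mul_mx_scalar scaleN1r opprK.
have SV v : v \in V -> S *m v = v.
  rewrite -b_span; apply: fixmx_span => w b_w.
  case/orP: (b_signed w b_w) => [/(C_all _ b_w)|/(C'_all _ b_w)] [j ->].
    by rewrite -col_mulmx SC.
  by rewrite -col_mulmx SC'.
(* The columns of [Q] thus lie in [V], where [S] acts as the identity. *)
have PhiQ : Phi *m Q = - Q.
  by rewrite /Q -scalemxAr mulmxBr mulmx1 PhiPhi -opprB scalerN.
have SQ : S *m Q = Q.
  apply: eq_cols => j; rewrite col_mulmx SV // mem_negative_eigenspace.
  by rewrite -col_mulmx PhiQ linearN.
have Sa : S^[*] = S by rewrite H_adjointD H_adjointK addrC.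
have Qa : Q^[*] = Q.
  by rewrite H_adjointZ H_adjointB H_adjoint1 Phi_sa fmorphV rmorph_nat.
(* Taking adjoints in [S *m Q = Q] gives [Q *m S = Q], whereas [QS] says [Q *m S = S]. *)
have -> : S = Q by rewrite -QS -[RHS]Qa -[in RHS]SQ H_adjointM Sa Qa.
by rewrite scalerA divff ?pnatr_eq0 // scale1r opprB addrC subrK.
Qed.

(** * The two factorizations, first abstractly and then over both scalar fields *)

Lemma two_neutral_factorizations (Phi W : 'M[K]_n) :
  H_selfadjoint conj H Phi -> involutory Phi ->
  hyperbolic conj H (negative_eigenspace Phi) ->
  HH_unitary conj (H *m Phi) H W ->
  exists X1 X2 : 'M[K]_n,
    [/\ Phi <> 1%:M -> X1 <> X2,
        [/\ W = X1 *m (X1 *m W), H_unitary conj H (X1 *m W)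
          & H_normal_H_neutral_involutory conj H X1]
      & [/\ W = X2 *m (X2 *m W), H_unitary conj H (X2 *m W)
          & H_normal_H_neutral_involutory conj H X2]].
Proof.
move=> Phi_sa PhiPhi Phi_hyp W_unitary.
(* Unitarity reads [W^[*] *m (Phi *m W) = 1]. Commuting these mutually inverse factors gives [Phi *m
   W *m W^[*] = 1], and [Phi] is its own inverse. *)
have WW : W *m W^[*] = Phi.
  have WaPhiW : W^[*] *m (Phi *m W) = 1%:M.
    by rewrite -(mulVmx H_unit) -[X in _ = _ *m X]W_unitary /H_adjoint !mulmxA.
  rewrite -[RHS]mulmx1 -(mulmx1C WaPhiW).
  by move: (W^[*]) => Y; rewrite !mulmxA PhiPhi mul1mx.
have [P [PP PPa PaP PhiE]] :=
  neutral_projection_exists Phi_sa PhiPhi Phi_hyp.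
exists (1%:M - 2 *: P), (1%:M - 2 *: P^[*]); split.
(* If the two reflections agreed, then [P = P^[*]], so [P = P *m P = P *m P^[*] = 0] and [Phi] would
   be the identity. *)
- move=> Phi_neq1 /addrI/oppr_inj/scalerI; rewrite pnatr_eq0 => /(_ isT) P_Pa.
  have P0 : P = 0 by rewrite -PP {2}P_Pa PPa.
  by apply: Phi_neq1; rewrite PhiE -P_Pa P0 addr0 scaler0 subr0.
- exact: (reflection_factorization PP PPa PaP PhiPhi WW PhiE).
apply: (reflection_factorization _ _ _ PhiPhi WW); rewrite ?H_adjointK //.
- by rewrite -H_adjointM PP.
- by rewrite (addrC _ P).
Qed.

End NeutralProjection.
End HAdjoint.

Theorem theorem5p5 (R : realType) (F : base_field) (n : nat)
    (H Phi W : 'M[scalars R F]_n)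
    (H_nonsingular : H \in unitmx)
    (H_sa : selfadjoint (@conj_scalars R F) H)
    (Phi_Hsa : H_selfadjoint (@conj_scalars R F) H Phi)
    (Phi_inv : involutory Phi)
    (Phi_hyp : hyperbolic (@conj_scalars R F) H (negative_eigenspace Phi))
    (W_unitary : HH_unitary (@conj_scalars R F) (H *m Phi) H W) :
  (exists X L : 'M[scalars R F]_n,
     [/\ W = X *m L,
         H_unitary (@conj_scalars R F) H L
       & H_normal_H_neutral_involutory (@conj_scalars R F) H X])
  /\
  (* for Phi = 1 the factorization is unique: X = 1 and L = W *)
  (Phi <> 1%:M ->
   exists X1 L1 X2 L2 : 'M[scalars R F]_n,
     [/\ (X1, L1) <> (X2, L2),
         [/\ W = X1 *m L1,
             H_unitary (@conj_scalars R F) H L1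
           & H_normal_H_neutral_involutory (@conj_scalars R F) H X1]
       & [/\ W = X2 *m L2,
             H_unitary (@conj_scalars R F) H L2
           & H_normal_H_neutral_involutory (@conj_scalars R F) H X2]]).
Proof.
suff [X1 [X2 [X_neq X1P X2P]]] : exists X1 X2 : 'M[scalars R F]_n,
    [/\ Phi <> 1%:M -> X1 <> X2,
        [/\ W = X1 *m (X1 *m W), H_unitary (@conj_scalars R F) H (X1 *m W)
          & H_normal_H_neutral_involutory (@conj_scalars R F) H X1]
      & [/\ W = X2 *m (X2 *m W), H_unitary (@conj_scalars R F) H (X2 *m W)
          & H_normal_H_neutral_involutory (@conj_scalars R F) H X2]].
  split; first by exists X1, (X1 *m W).
  move=> /X_neq X12; exists X1, (X1 *m W), X2, (X2 *m W).
  by split=> // -[].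
case: F H Phi W H_nonsingular H_sa Phi_Hsa Phi_inv Phi_hyp W_unitary
  => /= {}H {}Phi {}W H_unit {}H_sa Phi_sa PhiPhi {}Phi_hyp {}W_unitary.
- apply: (@two_neutral_factorizations R idfun _ n H H_unit H_sa _ Num.sqrt) => //.
  + by move=> x _; apply: num_real.
  + by move=> x x_gt0; rewrite sqr_sqrtr ?ltW.
(* A positive complex number has zero imaginary part, so the real square root of its real part
   serves as [s]. *)
apply: (@two_neutral_factorizations R[i] (@conjc R) _ n H H_unit H_sa _
  (fun x => (Num.sqrt (complex.Re x))%:C%C)) => //.
- exact: conjcK.
- by case=> a b [/eqP]; rewrite complex_real eqNr.
- by move=> x _; exact: conjc_real.
case=> a b; rewrite ltcE /= => /andP[/eqP -> a_gt0].
by rewrite -rmorphXn /= sqr_sqrtr ?ltW.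
Qed.
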